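(* Let $n\ge1$ and let $M\subseteq\mathbb{Z}^n$ be a submodule. Then the graph $\widetilde{G}_{\mathcal{V}}$ is finite; for every maximal clique of $\widetilde{G}_{\mathcal{V}}$, the union of its vertices (considered as subsets of $\mathbb{N}^n$) is a maximal compatible order ideal (mod $M$); and every maximal compatible order ideal (mod $M$) is obtained in this way from a maximal clique of $\widetilde{G}_{\mathcal{V}}$.
   Context: $\mathbb{N}$ denotes the non-negative integers. For $u,v\in\mathbb{N}^n$, $u\preceq v$ means componentwise $\le$, and $D(u)=\{v\in\mathbb{N}^n\mid v\preceq u\}$. An order ideal is a subset $\mathcal{O}\subseteq\mathbb{N}^n$ (finite or infinite) with $D(u)\subseteq\mathcal{O}$ for all $u\in\mathcal{O}$. Write $a\equiv_M b$ (equivalent mod $M$) if $a-b\in M$. An order ideal is compatible (mod $M$) if any two equivalent elements of it are equal, and maximal compatible if it is compatible and maximal w.r.t. inclusion among compatible order ideals. $\mathcal{V}\subseteq\mathbb{N}^n$ is the union of all compatible order ideals. For $c\in\mathbb{Z}^n$, $c^+$ and $c^-$ have components $\max(c_i,0)$ and $\max(-c_i,0)$. Let $P=\{k\in\mathbb{N}^n\mid k_j\ne0\ \forall j\}$, $-P=\{-k\mid k\in P\}$, and $\mathcal{X}=\{(c^+,c^-)\mid c\in M\setminus(P\cup -P\cup\{0\})\}\subseteq\mathbb{N}^n\times\mathbb{N}^n$. For $a=(a_0,a_1),b=(b_0,b_1)\in\mathcal{X}$ put $a\sqsubseteq b$ if ($a_0\preceq b_0$ and $a_1\preceq b_1$)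 or ($a_0\preceq b_1$ and $a_1\preceq b_0$). $\mathcal{X}_1$ is the set of minimal elements of $\mathcal{X}$, i.e. those $a\in\mathcal{X}$ such that every $b\in\mathcal{X}$ with $b\sqsubseteq a$ also satisfies $a\sqsubseteq b$. For $u\in\mathcal{V}$ set $R_u=\{v\in\mathcal{V}\mid \text{for all } a\in\mathcal{X}_1,\ a_0\in D(v)\text{ iff }a_0\in D(u)\}$; these sets partition $\mathcal{V}$. The vertices of $\widetilde{G}_{\mathcal{V}}$ are the distinct sets $R_u$, $u\in\mathcal{V}$; two distinct vertices $R_u,R_v$ are joined by an edge if and only if $D(u)\cup D(v)$ contains no two distinct elements equivalent mod $M$ (this does not depend on the choice of representatives $u,v$). A maximal clique is a clique (set of pairwise adjacent vertices) maximal w.r.t. inclusion. *)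

(* Defs.v *)
From HB Require Import structures.
From mathcomp Require Import all_boot all_order all_algebra.
From mathcomp Require Import boolp classical_sets functions cardinality.

(* Mathematical Components, with classical sets. *)

Set Implicit Arguments.
Unset Strict Implicit.
Unset Printing Implicit Defensive.

Import Order.TTheory GRing.Theory Num.Theory.
Local Open Scope classical_set_scope.
Local Open Scope ring_scope.

Definition maximal_sets (T : Type) (F : set (set T)) : set (set T) :=
  [set A | F A /\ forall B, F B -> A `<=` B -> B = A].

Definition vecz (n : nat) (u : 'rV[nat]_n) : 'rV[int]_n := map_mx Posz u.

Definition vle (n : nat) (u v : 'rV[nat]_n) : Prop :=
  forall j, (u ord0 j <= v ord0 j)%N.

Definition down (n : nat) (u : 'rV[nat]_n) : set 'rV[nat]_n :=
  [set v | vle v u].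

Definition order_ideal (n : nat) (O : set 'rV[nat]_n) : Prop :=
  forall u, O u -> down u `<=` O.

Definition equiv_mod (n : nat) (M : {pred 'rV[int]_n}) (a b : 'rV[nat]_n) :
    Prop :=
  vecz a - vecz b \in M.

(* This is stated for arbitrary sets because adjacency in the graph below
   applies it to D(u) `|` D(v). *)
Definition compatible (n : nat) (M : {pred 'rV[int]_n})
    (S : set 'rV[nat]_n) : Prop :=
  forall a b, S a -> S b -> equiv_mod M a b -> a = b.

Definition compatible_ideals (n : nat) (M : {pred 'rV[int]_n}) :
    set (set 'rV[nat]_n) :=
  [set O | order_ideal O /\ compatible M O].

Definition maximal_compatible_ideals (n : nat) (M : {pred 'rV[int]_n}) :
    set (set 'rV[nat]_n) :=
  maximal_sets (compatible_ideals M).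

Definition calV (n : nat) (M : {pred 'rV[int]_n}) : set 'rV[nat]_n :=
  \bigcup_(O in compatible_ideals M) O.

(* The natural-number absolute value only changes the type here, since its
   argument is nonnegative. *)
Definition pos_part (n : nat) (c : 'rV[int]_n) : 'rV[nat]_n :=
  map_mx (fun x : int => absz (Num.max x 0)) c.

Definition neg_part (n : nat) (c : 'rV[int]_n) : 'rV[nat]_n :=
  map_mx (fun x : int => absz (Num.max (- x) 0)) c.

Definition calP (n : nat) : set 'rV[nat]_n :=
  [set k | forall j, k ord0 j <> 0%N].

Definition calX (n : nat) (M : {pred 'rV[int]_n}) :
    set ('rV[nat]_n * 'rV[nat]_n) :=
  [set (pos_part c, neg_part c) | c in
    [set c | c \in M] `\`
      ([set vecz k | k in @calP n] `|` [set - vecz k | k in @calP n]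
        `|` [set 0])].

Definition sqle (n : nat) (a b : 'rV[nat]_n * 'rV[nat]_n) : Prop :=
  (vle a.1 b.1 /\ vle a.2 b.2) \/ (vle a.1 b.2 /\ vle a.2 b.1).

(* [sqle] is only a preorder: it identifies (a0, a1) with (a1, a0). *)
Definition calX1 (n : nat) (M : {pred 'rV[int]_n}) :
    set ('rV[nat]_n * 'rV[nat]_n) :=
  [set a | calX M a /\ forall b, calX M b -> sqle b a -> sqle a b].

Definition Rclass (n : nat) (M : {pred 'rV[int]_n}) (u : 'rV[nat]_n) :
    set 'rV[nat]_n :=
  [set v | calV M v /\
    forall a, calX1 M a -> (down v a.1 <-> down u a.1)].

Definition vertices (n : nat) (M : {pred 'rV[int]_n}) :
    set (set 'rV[nat]_n) :=
  [set Rclass M u | u in calV M].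

(* Whether [down u `|` down v] is compatible depends only on the classes of
   u and v when M is a submodule, so quantifying existentially over the
   representatives is harmless. *)
Definition adjacent (n : nat) (M : {pred 'rV[int]_n})
    (A B : set 'rV[nat]_n) : Prop :=
  A <> B /\
  exists u v, [/\ calV M u, calV M v, A = Rclass M u, B = Rclass M v &
    compatible M (down u `|` down v)].

Definition cliques (n : nat) (M : {pred 'rV[int]_n}) :
    set (set (set 'rV[nat]_n)) :=
  [set C | C `<=` vertices M /\
    forall A B, C A -> C B -> A <> B -> adjacent M A B].

Definition maximal_cliques (n : nat) (M : {pred 'rV[int]_n}) :
    set (set (set 'rV[nat]_n)) :=
  maximal_sets (cliques M).

(* Main.v *)
Require Import Defs.
From HB Require Import structures.
From mathcomp Require Import all_boot all_order all_algebra.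
From mathcomp Require Import boolp classical_sets functions cardinality.
From mathcomp Require Import zify.

Set Implicit Arguments.
Unset Strict Implicit.
Unset Printing Implicit Defensive.

Import Order.TTheory GRing.Theory Num.Theory.
Local Open Scope classical_set_scope.
Local Open Scope ring_scope.

(** Call u and v joinable if D(u) and D(v) together contain no two distinct
equivalent elements.  An order ideal is compatible exactly when its elements
are pairwise joinable, so compatible order ideals behave like cliques of the
graph on V whose edges are the joinable pairs.  The theorem says that this
graph may be replaced by its quotient by the classes R_u, and that the quotient
is finite.

The quotient makes sense because joinability of two elements u, v of V is
decided by X1 ([joinableP]).  Each pair of X1 consists of two distinct
equivalent elements, so it may not have one component in D(u) and the other in D(v).
Conversely, distinct equivalent elements must come one from each side, say x in
D(u) and y in D(v); their difference c = x - y has c^+ in D(u) and c^- in D(v).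
Neither c nor -c lies in P, since then one of D(u), D(v) would contain 0 and a
distinct element equivalent to it; hence (c^+, c^-) lies in X, and below it
there is a pair (a0, a1) of X1, with a0 in D(u) and a1 in D(v).  As X1 is
stable under exchange of the components, the classes R_u and R_v know
which components of X1 lie in D(u) and in D(v), so joinability depends only
on the classes ([joinable_Rclass]).

The quotient is finite because R_u is determined by the subset of X1 of those
a with a0 in D(u), and X1 is finite: it is an antichain of N^(2n), so Dickson's
lemma applies ([dickson], [finite_calX1]).

Both maximality statements then say that something joinable to everything
already belongs.  A class joinable to all the classes of a maximal clique lies
in it ([maximal_clique_mem]); this gives closure under passing to smaller
elements, as u' <= u is joinable to whatever u is joinable to, and also
maximality of the union.  An element w of V joinable to all elements of a
maximal ideal O lies in O, because the union of O and D(w) is again a compatible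
ideal ([maximal_ideal_mem]); hence O is a union of classes and these form a
maximal clique. *)

(* [classical_sets] has its own [down], the downward closure of a set. *)
Local Notation down := Defs.down.

(** * Dickson's lemma *)

(** Each tail of f attains its minimum; jumping repeatedly to a place where the
minimum of the remaining tail is attained gives a nondecreasing sequence. *)
Lemma nondecreasing_subsequence (f : nat -> nat) :
  exists2 g : nat -> nat, {homo g : i j / (i < j)%N} &
    {homo f \o g : i j / (i <= j)%N}.
Proof.
have tail_min N :
    exists i, (N <= i)%N /\ forall j, (N <= j)%N -> (f i <= f j)%N.
  have ex : exists m, `[< exists2 i, (N <= i)%N & f i = m >].
    by exists (f N); apply/asboolP; exists N.
  case: (ex_minnP ex) => m /asboolP[i Ni <-] min.
  by exists i; split=> // j Nj; apply: min; apply/asboolP; exists j.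
have [h hP] := choice tail_min.
pose g := fix g k := if k is k'.+1 then h (g k').+1 else h 0%N.
exists g.
  by apply: homo_ltn => [? ? ?|k]; [exact: ltn_trans | have [] := hP (g k).+1].
apply: homo_leq => [//|? ? ?|k /=]; first exact: leq_trans.
have [le_next _] := hP (g k).+1.
case: k le_next => [|k] /= le_next; first exact: (hP 0%N).2.
have [le_k min_k] := hP (g k).+1.
by apply: min_k; lia.
Qed.

Lemma jointly_nondecreasing_subsequence (I : eqType) (s : seq I)
    (f : I -> nat -> nat) :
  exists2 g : nat -> nat, {homo g : i j / (i < j)%N} &
    {in s, forall i, {homo f i \o g : j k / (j <= k)%N}}.
Proof.
elim: s => [|i s [g g_inc fg]]; first by exists id.
have [h h_inc fgh] := nondecreasing_subsequence (f i \o g).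
exists (g \o h) => [j k jk|x]; first exact/g_inc/h_inc.
rewrite inE => /orP[/eqP->|xs] j k jk; first exact: fgh.
apply: (fg _ xs); move: jk; rewrite leq_eqVlt => /orP[/eqP->//|/h_inc].
exact: ltnW.
Qed.

(** Dickson's lemma, for points x of S with coordinates c i x: an antichain for
the componentwise order is finite.  An injective sequence in an infinite S has
a subsequence along which all coordinates are nondecreasing, and its first two
terms are comparable. *)
Lemma dickson (I : finType) (T : Type) (c : I -> T -> nat) (S : set T) :
  (forall x y, S x -> S y -> (forall i, (c i x <= c i y)%N) -> x = y) ->
  finite_set S.
Proof.
move=> anti; apply: contrapT => /infiniteP/card_leP/unsquash f.
pose x k := f (SigSub (mem_set (Logic.I : [set: nat] k))).
have x_inj : injective x.
  by move=> j k /(@inj _ _ _ f); rewrite !inE => /(_ Logic.I Logic.I)[].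
have [g g_inc cg] :=
  jointly_nondecreasing_subsequence (enum I) (fun i k => c i (val (x k))).
have /val_inj/x_inj g01 : val (x (g 0%N)) = val (x (g 1%N)).
  apply: anti; try exact: set_valP.
  by move=> i; apply: (cg i); rewrite ?mem_enum.
by have := g_inc 0%N 1%N isT; rewrite g01 ltnn.
Qed.

(** * Componentwise order, and positive and negative parts *)

Section Order.
Variable n : nat.
Implicit Types (u v w : 'rV[nat]_n) (a b : 'rV[nat]_n * 'rV[nat]_n).

Lemma vle_refl u : vle u u. Proof. by []. Qed.

Lemma vle_trans u v w : vle u v -> vle v w -> vle u w.
Proof. by move=> uv vw j; apply: leq_trans (uv j) (vw j). Qed.

Lemma vle_anti u v : vle u v -> vle v u -> u = v.
Proof.
by move=> uv vu; apply/rowP => j; apply/eqP; rewrite eqn_leq uv vu.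
Qed.

(** A strictly monotone rank for [vle], for finding minimal elements. *)
Definition weight u := (\sum_j u ord0 j)%N.

Lemma vle_weight u v : vle u v -> (weight u <= weight v)%N.
Proof. by move=> uv; apply: leq_sum => j _; apply: uv. Qed.

Lemma vle_weight_eq u v : vle u v -> (weight v <= weight u)%N -> vle v u.
Proof.
move=> uv; rewrite (geq_leqif (leqif_sum (fun j _ => leqif_eq (uv j)))).
by move=> /forallP eq_uv j; rewrite (eqP (eq_uv j)).
Qed.

Lemma sqle_refl a : sqle a a.
Proof. by left; split; apply: vle_refl. Qed.

Lemma sqle_trans a b c : sqle a b -> sqle b c -> sqle a c.
Proof.
move=> [] [p q] [] [r s]; [left|right|right|left]; split;
  first [exact: vle_trans p r|exact: vle_trans p s
     |exact: vle_trans q r|exact: vle_trans q s].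
Qed.

Lemma sqle_weight_eq a b : sqle a b ->
  (weight b.1 + weight b.2 <= weight a.1 + weight a.2)%N -> sqle b a.
Proof.
move=> [] [p q] le; [left|right]; split; apply: vle_weight_eq => //;
  move: (vle_weight p) (vle_weight q) le; lia.
Qed.

Lemma order_ideal_downU (O : set 'rV[nat]_n) w :
  order_ideal O -> order_ideal (O `|` down w).
Proof.
move=> Oideal x [Ox|xw] y yx; [left; exact: Oideal yx|right].
exact: vle_trans yx xw.
Qed.

(* The operations on integer vectors are computed entrywise; these are the
   scalar identities. *)
Lemma int_pos_negK (x : int) :
  Posz (absz (Num.max x 0)) - Posz (absz (Num.max (- x) 0)) = x.
Proof. lia. Qed.

Lemma int_posK (x : nat) : absz (Num.max (Posz x) 0)%R = x.
Proof. lia. Qed.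

Lemma int_pos_sub (x y : nat) : (absz (Num.max (Posz x - Posz y) 0)%R <= x)%N.
Proof. lia. Qed.

Lemma int_neg_sub (x y : nat) :
  (absz (Num.max (- (Posz x - Posz y)) 0)%R <= y)%N.
Proof. lia. Qed.

Lemma pos_neg_partK (c : 'rV[int]_n) :
  vecz (pos_part c) - vecz (neg_part c) = c.
Proof. apply/rowP => j; rewrite !mxE; exact: int_pos_negK. Qed.

Lemma pos_partN (c : 'rV[int]_n) : pos_part (- c) = neg_part c.
Proof. by apply/rowP => j; rewrite !mxE. Qed.

Lemma neg_partN (c : 'rV[int]_n) : neg_part (- c) = pos_part c.
Proof. by rewrite -pos_partN opprK. Qed.

Lemma vecz_inj : injective (@vecz n).
Proof.
by move=> u v /rowP uv; apply/rowP => j; move: (uv j); rewrite !mxE => -[].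
Qed.

Lemma pos_part_sub u v : vle (pos_part (vecz u - vecz v)) u.
Proof. move=> j; rewrite !mxE; exact: int_pos_sub. Qed.

Lemma neg_part_sub u v : vle (neg_part (vecz u - vecz v)) v.
Proof. move=> j; rewrite !mxE; exact: int_neg_sub. Qed.

Lemma pos_part_vecz u : pos_part (vecz u) = u.
Proof. by apply/rowP => j; rewrite !mxE; exact: int_posK. Qed.

Lemma vecz0 : vecz 0 = 0 :> 'rV_n.
Proof. by apply/rowP => j; rewrite !mxE. Qed.

End Order.

(** * Joinable elements *)

Section Submodule.
Variables (n : nat) (M : {pred 'rV[int]_n}).
Hypothesis hM : GRing.submod_closed M.
Implicit Types (u v w : 'rV[nat]_n) (a b : 'rV[nat]_n * 'rV[nat]_n).

Lemma submod_opp c : c \in M -> - c \in M.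
Proof.
case: hM => M0 /(_ (-1) c 0) MZ Mc; rewrite -scaleN1r -[_ *: _]addr0.
exact: MZ.
Qed.

Lemma compatibleS (S T : set 'rV[nat]_n) :
  S `<=` T -> compatible M T -> compatible M S.
Proof. by move=> ST cT a b /ST Ta /ST Tb; apply: cT. Qed.

(** The relation underlying adjacency.  The elements joinable to themselves are
those of V ([calVP]). *)
Definition joinable u v := compatible M (down u `|` down v).

Lemma joinableC u v : joinable u v -> joinable v u.
Proof. by rewrite /joinable setUC. Qed.

Lemma joinable_down u u' v : vle u' u -> joinable u v -> joinable u' v.
Proof.
move=> u'u; apply: compatibleS => x [xu'|xv]; [left|by right].
exact: vle_trans xu' u'u.
Qed.

Lemma ideal_joinable (O : set 'rV[nat]_n) u v :
  compatible_ideals M O -> O u -> O v -> joinable u v.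
Proof.
move=> [ideal comp] Ou Ov; apply: compatibleS comp => x [].
  exact: ideal Ou x.
exact: ideal Ov x.
Qed.

Lemma joinable_compatible (O : set 'rV[nat]_n) :
  (forall u v, O u -> O v -> joinable u v) -> compatible M O.
Proof.
by move=> OO a b Oa Ob; apply: (OO a b Oa Ob); [left|right]; apply: vle_refl.
Qed.

Lemma down_ideal w : joinable w w -> compatible_ideals M (down w).
Proof.
rewrite /joinable setUid => cw; split=> // u uw v vu; exact: vle_trans vu uw.
Qed.

Lemma calVP u : calV M u <-> joinable u u.
Proof.
split=> [[O OM Ou]|uu]; first exact: (ideal_joinable OM Ou Ou).
exists (down u); [exact: down_ideal|exact: vle_refl].
Qed.

Lemma calV_ideal (O : set 'rV[nat]_n) : compatible_ideals M O -> O `<=` calV M.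
Proof. by move=> OM u Ou; exists O. Qed.

(** * The minimal pairs X1 *)

(** Exchanging the components of a pair amounts to replacing c by -c. *)
Lemma calX_swap a : calX M a -> calX M (a.2, a.1).
Proof.
move=> [c [cM cP] <-]; exists (- c); last by rewrite pos_partN neg_partN.
split=> [|[[[k Pk E]|[k Pk E]]|E]]; first exact: submod_opp.
- by apply: cP; left; right; exists k; rewrite ?E ?opprK.
- by apply: cP; left; left; exists k => //; exact: oppr_inj.
- by apply: cP; right; apply: oppr_inj; rewrite E oppr0.
Qed.

Lemma sqle_swapl a b : sqle (a.2, a.1) b <-> sqle a b.
Proof. by split=> -[[? ?]|[? ?]]; [right|left|right|left]. Qed.

Lemma sqle_swapr a b : sqle a (b.2, b.1) <-> sqle a b.
Proof. by split=> -[[? ?]|[? ?]]; [right|left|right|left]. Qed.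

Lemma calX1_swap a : calX1 M a -> calX1 M (a.2, a.1).
Proof.
move=> [Xa mina]; split=> [|b Xb /sqle_swapr ba]; first exact: calX_swap.
exact/sqle_swapl/mina.
Qed.

(** A pair of least total weight among those of X below a is minimal, since
being below a pair of the same weight is symmetric. *)
Lemma calX1_below a : calX M a -> exists2 b, calX1 M b & sqle b a.
Proof.
move=> Xa.
have ex : exists m, `[< exists b, [/\ calX M b, sqle b a &
    (weight b.1 + weight b.2)%N = m] >].
  by eexists; apply/asboolP; exists a; split=> //; exact: sqle_refl.
case: (ex_minnP ex) => _ /asboolP[b [Xb ba <-]] minb.
exists b => //; split=> // c Xc cb; apply: sqle_weight_eq => //.
by apply: minb; apply/asboolP; exists c; split=> //; exact: sqle_trans cb ba.
Qed.

(** A minimal pair below a may be below it crosswise; exchanging its components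
puts it below a componentwise. *)
Lemma calX1_below_split a : calX M a ->
  exists2 b, calX1 M b & vle b.1 a.1 /\ vle b.2 a.2.
Proof.
move=> /calX1_below[b Xb [ba|[b12 b21]]]; first by exists b.
by exists (b.2, b.1); [exact: calX1_swap|].
Qed.

(** Minimality gives b below a as well, componentwise or crosswise; in the
second case all four components lie on a cycle of inequalities. *)
Lemma calX1_antichain a b : calX1 M a -> calX1 M b ->
  vle a.1 b.1 -> vle a.2 b.2 -> a = b.
Proof.
move=> [Xa _] [_ minb] le1 le2.
have [[ge1 ge2]|[ge1 ge2]] := minb a Xa (or_introl (conj le1 le2)).
  by apply: injective_projections; apply: vle_anti.
have le12 := vle_trans le1 ge1; have le21 := vle_trans le2 ge2.
apply: injective_projections; apply: vle_anti => //.
- exact: vle_trans ge1 le21.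
- exact: vle_trans ge2 le12.
Qed.

Lemma finite_calX1 : finite_set (calX1 M).
Proof.
pose c (i : 'I_n + 'I_n) a :=
  match i with inl j => a.1 ord0 j | inr j => a.2 ord0 j end.
apply: (@dickson _ _ c) => a b Xa Xb le; apply: calX1_antichain => // j.
  exact: le (inl j).
exact: le (inr j).
Qed.

(** The difference c^+ - c^- = c lies in M and is nonzero, so every pair in X is
an obstruction to compatibility. *)
Lemma calX_equiv a : calX M a -> equiv_mod M a.1 a.2 /\ a.1 <> a.2.
Proof.
move=> [c [cM cP] <-] /=; rewrite /equiv_mod pos_neg_partK; split=> // E.
by apply: cP; right; rewrite /= -[c]pos_neg_partK E subrr.
Qed.

(** Were the difference c of u and v in P or -P, then c or -c would be an
element k of N^n below u or v; but k is equivalent to 0, which also lies below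
u and v, so k = 0. *)
Lemma calX_diff u v : calV M u -> calV M v -> equiv_mod M u v -> u <> v ->
  calX M (pos_part (vecz u - vecz v), neg_part (vecz u - vecz v)).
Proof.
move=> /calVP Vu /calVP Vv uv neq; set c := vecz u - vecz v.
have notP k w : joinable w w -> vle k w -> vecz k \in M -> k = 0.
  move=> ww kw kM; apply: (ww k 0); [by left|by left=> j; rewrite mxE|].
  by rewrite /equiv_mod vecz0 subr0.
have c0 : c <> 0 by move/subr0_eq/vecz_inj.
exists c => //; split=> // -[[[k Pk E]|[k Pk E]]|//]; apply: c0.
- rewrite -E (notP k u) ?vecz0 ?E // -[k]pos_part_vecz E.
  exact: pos_part_sub.
- have {}E : vecz k = - c by rewrite -E opprK.
  rewrite -[c]opprK -E (notP k v) ?vecz0 ?oppr0 ?E //; last exact: submod_opp.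
  by rewrite -[k]pos_part_vecz E pos_partN; exact: neg_part_sub.
Qed.

(** Equivalent elements of D(u), or of D(v), are equal because u and v lie in V.
If they come from different sides, a pair of X1 below the parts of their
difference obstructs joinability.  Because X1 is stable under exchange of the
components, only one of the two orders has to be tested. *)
Lemma joinableP u v : calV M u -> calV M v ->
  joinable u v <-> forall a, calX1 M a -> ~ (vle a.1 u /\ vle a.2 v).
Proof.
move=> Vu Vv; split=> [uv a [Xa _] [a1u a2v]|noX x y].
  have [eqM neq] := calX_equiv Xa.
  by apply: neq; apply: uv => //; [left|right].
have cross : forall x y, vle x u -> vle y v -> equiv_mod M x y -> x = y.
  move=> {}x {}y xu yv xy; apply: contrapT => neq.
  have Vx : calV M x := calV_ideal (down_ideal ((calVP u).1 Vu)) xu.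
  have Vy : calV M y := calV_ideal (down_ideal ((calVP v).1 Vv)) yv.
  have [a Xa [a1 a2]] := calX1_below_split (calX_diff Vx Vy xy neq).
  apply: (noX a Xa); split.
    exact: vle_trans a1 (vle_trans (pos_part_sub _ _) xu).
  exact: vle_trans a2 (vle_trans (neg_part_sub _ _) yv).
move=> [xu|xv] [yu|yv] xy.
- by apply: ((calVP u).1 Vu) xy; left.
- exact: cross.
- by apply/esym/cross => //; rewrite /equiv_mod -opprB; exact: submod_opp.
- by apply: ((calVP v).1 Vv) xy; left.
Qed.

(** * The classes R_u *)

Lemma Rclass_refl u : calV M u -> Rclass M u u.
Proof. by []. Qed.

Lemma Rclass_sub u v : Rclass M u v -> Rclass M v `<=` Rclass M u.
Proof.
move=> [_ vu] w [Vw wv]; split=> // a Xa.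
exact: iff_trans (wv a Xa) (vu a Xa).
Qed.

Lemma Rclass_eq u v : calV M u -> Rclass M u v -> Rclass M v = Rclass M u.
Proof.
move=> Vu uv; apply/seteqP; split; apply: Rclass_sub => //.
by case: uv => Vv vu; split=> // a Xa; apply: iff_sym (vu a Xa).
Qed.

(** The criterion [joinableP] involves u only through its class. *)
Lemma joinable_Rclass u u' v : calV M u -> calV M v -> Rclass M u u' ->
  joinable u v -> joinable u' v.
Proof.
move=> Vu Vv [Vu' uu'] /(joinableP Vu Vv) noX.
apply/joinableP => // a Xa [/(uu' a Xa) a1u a2v]; exact: noX Xa _.
Qed.

Lemma joinable_Rclass2 u u' v v' : calV M u -> calV M v ->
  Rclass M u u' -> Rclass M v v' -> joinable u v -> joinable u' v'.
Proof.
move=> Vu Vv Ru Rv uv; apply: (joinable_Rclass Vu Rv.1 Ru).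
exact/joinableC/(joinable_Rclass Vv Vu Rv)/joinableC.
Qed.

Lemma adjacent_joinable u v : calV M u -> calV M v ->
  adjacent M (Rclass M u) (Rclass M v) -> joinable u v.
Proof.
move=> Vu Vv [_ [u' [v' [Vu' Vv' Eu Ev uv']]]].
apply: (joinable_Rclass2 Vu' Vv') uv'; rewrite -?Eu -?Ev; exact: Rclass_refl.
Qed.

(** For distinct classes this is adjacency; two elements of one class are
joinable because one of them is joinable to itself. *)
Lemma clique_joinable C u v : cliques M C -> calV M u -> calV M v ->
  C (Rclass M u) -> C (Rclass M v) -> joinable u v.
Proof.
move=> [_ adj] Vu Vv Cu Cv.
have [E|neq] := pselect (Rclass M u = Rclass M v).
  have uv : Rclass M v u by rewrite -E; exact: Rclass_refl.
  exact: (joinable_Rclass Vv Vv uv ((calVP v).1 Vv)).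
exact/adjacent_joinable/adj.
Qed.

(** * Cliques and ideals *)

Lemma clique_add C w : cliques M C -> calV M w ->
  (forall v, calV M v -> C (Rclass M v) -> joinable v w) ->
  cliques M (C `|` [set Rclass M w]).
Proof.
move=> [CV adj] Vw wC; split=> [A [/CV//|->]|]; first by exists w.
move=> A B [CA|->] [CB|->] AB //; first exact: adj.
- case: (CV A CA) => u Vu E; rewrite -E in CA AB *.
  by split=> //; exists u, w; split=> //; exact: wC.
- case: (CV B CB) => u Vu E; rewrite -E in CB AB *.
  by split=> //; exists w, u; split=> //; exact/joinableC/wC.
Qed.

Lemma maximal_clique_mem C w : maximal_cliques M C -> calV M w ->
  (forall v, calV M v -> C (Rclass M v) -> joinable v w) -> C (Rclass M w).
Proof.
move=> [Ccl maxC] Vw wC.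
rewrite -(maxC _ (clique_add Ccl Vw wC)); first by right.
exact: subsetUl.
Qed.

Lemma clique_bigcupP C u : C `<=` vertices M ->
  (\bigcup_(A in C) A) u <-> calV M u /\ C (Rclass M u).
Proof.
move=> CV; split=> [[A CA Au]|[Vu Cu]]; last by exists (Rclass M u).
have [v Vv E] := CV A CA; rewrite -E in CA Au.
by rewrite (Rclass_eq Vv Au); split=> //; case: Au.
Qed.

(** The set O extended by D(w) is still a compatible ideal, as elements of D(w)
are joinable to whatever w is. *)
Lemma maximal_ideal_mem (O : set 'rV[nat]_n) w :
  maximal_compatible_ideals M O -> calV M w ->
  (forall v, O v -> joinable v w) -> O w.
Proof.
move=> [OM maxO] /calVP ww Ow.
suff -> : O = O `|` down w by right; exact: vle_refl.
apply/esym/maxO; last exact: subsetUl.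
split; first exact: order_ideal_downU OM.1.
apply: joinable_compatible => x y [Ox|xw] [Oy|yw].
- exact: ideal_joinable OM Ox Oy.
- exact/joinableC/(joinable_down yw)/joinableC/Ow.
- exact/(joinable_down xw)/joinableC/Ow.
- exact: ideal_joinable (down_ideal ww) xw yw.
Qed.

(** R_u depends only on which of the finitely many a in X1 have a0 in D(u), so
the vertices are among the values of a function on {0,1}^X1. *)
Lemma finite_vertices : finite_set (vertices M).
Proof.
have /finite_seqP[s X1E] := finite_calX1.
pose R (p : {ffun seq_sub s -> bool}) := [set v | calV M v /\
  forall i : seq_sub s, down v (val i).1 <-> p i].
have : finite_set (range R) by apply: finite_image; exact: finite_finset.
apply: sub_finite_set => A [u Vu <-].
exists [ffun i : seq_sub s => `[< down u (val i).1 >]] => //.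
apply/seteqP; split=> v [Vv vu]; split=> //.
  move=> a; rewrite X1E /= => sa.
  by apply: iff_trans (vu (SeqSub sa)) _; rewrite ffunE /= asboolE.
move=> i; rewrite ffunE asboolE; apply: vu; rewrite X1E; exact: valP.
Qed.

Lemma maximal_clique_union C : maximal_cliques M C ->
  maximal_compatible_ideals M (\bigcup_(A in C) A).
Proof.
move=> maxC; have [Ccl _] := maxC; have inC u := clique_bigcupP u Ccl.1.
split; first split.
- move=> w /inC[Vw Cw] x xw; have ww := (calVP w).1 Vw.
  have Vx : calV M x := calV_ideal (down_ideal ww) xw.
  apply/inC; split=> //; apply: maximal_clique_mem => // v Vv Cv.
  exact/joinableC/(joinable_down xw)/(clique_joinable Ccl).
- apply: joinable_compatible => u v /inC[Vu Cu] /inC[Vv Cv].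
  exact: clique_joinable Ccl _ _ _ _.
move=> B BM CB; apply/seteqP; split=> // b Bb.
have Vb := calV_ideal BM Bb.
apply/inC; split=> //; apply: maximal_clique_mem => // v Vv Cv.
by apply: ideal_joinable BM _ Bb; apply/CB/inC.
Qed.

(** An element of R_u is joinable to whatever u is, hence to all of O. *)
Lemma maximal_ideal_Rclass (O : set 'rV[nat]_n) u :
  maximal_compatible_ideals M O -> O u -> Rclass M u `<=` O.
Proof.
move=> maxO Ou w uw; have OV := calV_ideal maxO.1.
apply: maximal_ideal_mem uw.1 _ => // v Ov.
apply/joinableC/(joinable_Rclass (OV u Ou) (OV v Ov) uw).
exact: ideal_joinable maxO.1 Ou Ov.
Qed.

Lemma maximal_ideal_clique (O : set 'rV[nat]_n) :
  maximal_compatible_ideals M O -> maximal_cliques M [set Rclass M u | u in O].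
Proof.
move=> maxO; have OM := maxO.1; have OV := calV_ideal OM.
split; first split.
- by move=> _ [u Ou <-]; exists u => //; exact: OV.
- move=> _ _ [u Ou <-] [v Ov <-] neq; split=> //; exists u, v.
  by split=> //; [exact: OV|exact: OV|exact: ideal_joinable OM Ou Ov].
move=> C Ccl OC; apply/seteqP; split=> // A CA.
case: (Ccl.1 A CA) => w Vw E; rewrite -E in CA *; exists w => //.
apply: maximal_ideal_mem => // v Ov.
by apply: (clique_joinable Ccl) => //; [exact: OV|apply: OC; exists v].
Qed.

Lemma maximal_ideal_bigcup (O : set 'rV[nat]_n) :
  maximal_compatible_ideals M O ->
  O = \bigcup_(A in [set Rclass M u | u in O]) A.
Proof.
move=> maxO; apply/seteqP; split=> [u Ou|w [_ [u Ou <-]]].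
  by exists (Rclass M u); [exists u|exact/Rclass_refl/(calV_ideal maxO.1)].
exact: maximal_ideal_Rclass.
Qed.

End Submodule.

Theorem mainTheorem3 (n : nat) (hn : (0 < n)%N) (M : {pred 'rV[int]_n})
    (hM : GRing.submod_closed M) :
  [/\ finite_set (vertices M),
      forall C, maximal_cliques M C ->
        maximal_compatible_ideals M (\bigcup_(A in C) A)
    & forall O, maximal_compatible_ideals M O ->
        exists2 C, maximal_cliques M C & O = \bigcup_(A in C) A].
Proof.
split=> [|C maxC|O maxO].
- exact: finite_vertices.
- exact: maximal_clique_union.
- by exists [set Rclass M u | u in O];
    [exact: maximal_ideal_clique|exact: maximal_ideal_bigcup].
Qed.
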